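(* Suppose that $\mathcal{L}=\{A_\xi:\xi<\omega_1\}$ is a Luzin family, and that $\xi_\alpha,\eta_\alpha$ for $\alpha<\omega_1$ are ordinals satisfying $$\xi_\beta<\eta_\beta<\xi_\alpha<\eta_\alpha<\omega_1$$ for all $\beta<\alpha<\omega_1$. For $\alpha<\omega_1$ put $f_\alpha=1_{A_{\xi_\alpha}}-1_{A_{\eta_\alpha}}$. Then there is an uncountable $\Gamma\subseteq\omega_1$ such that $\{f_\alpha:\alpha\in\Gamma\}$ is an uncountable $2$-equilateral set consisting of elements of the unit sphere of $(\mathcal{X}_{\mathcal{L}},\|\cdot\|_\infty)$.
   Context: A family of subsets of $\mathbb{N}$ is almost disjoint if any two distinct members have finite intersection; all almost disjoint families considered are uncountable and consist of infinite sets. An almost disjoint family $\{A_\xi:\xi<\omega_1\}$ (with $A_\xi\neq A_\eta$ for $\xi\ne\eta$) is called a Luzin family if for every $\alpha<\omega_1$ the function $\alpha\to\mathbb{N}$ given by $\beta\mapsto\max(A_\beta\cap A_\alpha)$, $\beta<\alpha$, is finite-to-one (with the convention $\max\emptyset=0$). For an almost disjoint family $\mathcal{A}$, $\mathcal{X}_{\mathcal{A}}$ is the closed linear span in the real Banach space $(\ell_\infty(\mathbb{N}),\|\cdot\|_\infty)$ of $\{1_A:A\in\mathcal{A}\}\cup c_0$, where $1_A$ is the characteristic function of $A$. A subset $\mathcal{Y}$ of a Banach space is $2$-equilateral if $\|y-y'\|=2$ for any two distinct $y,y'\in\mathcal{Y}$. *)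

(* Defs.v *)
From HB Require Import structures.
From mathcomp Require Import all_boot all_order all_algebra.
From mathcomp Require Import all_classical all_reals all_analysis wochoice.

Set Implicit Arguments.
Unset Strict Implicit.
Unset Printing Implicit Defensive.

Import Order.TTheory GRing.Theory Num.Theory.
Import numFieldNormedType.Exports.

Local Open Scope classical_set_scope.
Local Open Scope ring_scope.

(* Up to order isomorphism, omega_1 is the only uncountable well-order all of
   whose proper initial segments are countable. *)
Definition is_omega1 (d : Order.disp_t) (W : orderType d) : Prop :=
  [/\ well_order (fun x y : W => (x <= y)%O),
      ~ countable [set: W] &
      forall a : W, countable [set b : W | (b < a)%O]].

Definition almost_disjoint (F : set (set nat)) : Prop :=
  forall A B, F A -> F B -> A <> B -> finite_set (A `&` B).

(* Almost disjoint families are always taken uncountable and made of infinite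
   sets. *)
Definition ad_family (F : set (set nat)) : Prop :=
  [/\ almost_disjoint F, ~ countable F & forall A, F A -> infinite_set A].

(* Only meaningful for finite S; the maximum of the empty set is 0. *)
Definition set_max (S : set nat) : nat := \big[maxn/0%N]_(n \in S) n.

Definition luzin_family (d : Order.disp_t) (W : orderType d)
    (A : W -> set nat) : Prop :=
  [/\ ad_family (range A), injective A &
      forall (a : W) (n : nat),
        finite_set [set b : W | (b < a)%O /\ set_max (A b `&` A a) = n]].

Section linfty.
Variable R : realType.

Definition bounded_seq : {pred nat -> R} := mem [set f | bounded_fun f].

Lemma bounded_seqP (f : nat -> R) :
  f \in bounded_seq <-> exists M, forall n, `|f n| <= M.
Proof.
rewrite inE /=; have FF : ProperFilter (globally [set: nat]).
  exact: (globally_properfilter (a := 0%N)).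
have bE := @ex_bound _ _ _ f _ FF.
split; first by move=> /bE[M fM]; exists M => n; exact: fM.
by move=> [M fM]; apply/bE; exists M => n _; exact: fM.
Qed.

Lemma bounded_seq_submod_closed : submod_closed bounded_seq.
Proof.
split; first by apply/bounded_seqP; exists 0 => n; rewrite normr0.
move=> a f g /bounded_seqP[M fM] /bounded_seqP[N gN].
apply/bounded_seqP; exists (`|a| * M + N) => n.
by rewrite (le_trans (ler_normD _ _))// lerD// normrM ler_wpM2l.
Qed.

HB.instance Definition _ :=
  GRing.isSubmodClosed.Build R (nat -> R) bounded_seq bounded_seq_submod_closed.

Record linfty := Linfty {
  linfty_fun :> nat -> R ;
  linfty_bounded : linfty_fun \in bounded_seq }.

HB.instance Definition _ := [isSub for linfty_fun].
HB.instance Definition _ := [Choice of linfty by <:].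
HB.instance Definition _ := [SubChoice_isSubLmodule of linfty by <:].

Definition linfty_norm (x : linfty) : R := sup (range (fun n => `|x n|)).

Lemma linfty_has_sup (x : linfty) : has_sup (range (fun n => `|x n|)).
Proof.
split; first by exists `|x 0%N|; exists 0%N.
have /bounded_seqP[M xM] := linfty_bounded x.
by exists M => _ [n _ <-].
Qed.

Lemma linfty_norm_ub (x : linfty) (n : nat) : `|x n| <= linfty_norm x.
Proof. by apply: ub_le_sup; [case: (linfty_has_sup x)|exists n]. Qed.

Lemma linfty_norm_le (x : linfty) (M : R) :
  (forall n, `|x n| <= M) -> linfty_norm x <= M.
Proof.
move=> xM; apply: ge_sup; first by case: (linfty_has_sup x).
by move=> _ [n _ <-].
Qed.

Lemma linfty_normD (x y : linfty) :
  linfty_norm (x + y) <= linfty_norm x + linfty_norm y.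
Proof.
apply: linfty_norm_le => n.
by rewrite (le_trans (ler_normD _ _))// lerD// linfty_norm_ub.
Qed.

Lemma linfty_normZ (a : R) (x : linfty) :
  linfty_norm (a *: x) = `|a| * linfty_norm x.
Proof.
apply/eqP; rewrite eq_le; apply/andP; split.
  apply: linfty_norm_le => n.
  by rewrite [leLHS]normrM ler_wpM2l// linfty_norm_ub.
have [->|a0] := eqVneq a 0.
  rewrite normr0 mul0r; exact: le_trans (linfty_norm_ub _ 0%N).
rewrite mulrC -ler_pdivlMr ?normr_gt0//; apply: linfty_norm_le => n.
rewrite ler_pdivlMr ?normr_gt0// mulrC -normrM.
exact: (linfty_norm_ub (a *: x) n).
Qed.

Lemma linfty_norm0_eq0 (x : linfty) : linfty_norm x = 0 -> x = 0.
Proof.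
move=> x0; apply: val_inj; apply/funext => n.
by apply/eqP; rewrite -normr_le0 -x0; exact: linfty_norm_ub.
Qed.

HB.instance Definition _ := Lmodule_isNormed.Build R linfty
  linfty_normD linfty_normZ linfty_norm0_eq0.

Lemma linfty_normE (x : linfty) : `|x| = sup (range (fun n => `|x n|)).
Proof. by []. Qed.

Lemma indic_bounded (A : set nat) : (\1_A : nat -> R) \in bounded_seq.
Proof.
by apply/bounded_seqP; exists 1 => n; rewrite indicE normr_nat lern1 leq_b1.
Qed.

Definition linfty_indic (A : set nat) : linfty := Linfty (indic_bounded A).

Definition c0 : set linfty := [set x | (x : nat -> R) @ \oo --> (0 : R)].

Definition linear_span (V : lmodType R) (S : set V) : set V :=
  [set v | exists (n : nat) (c : 'I_n -> R) (x : 'I_n -> V),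
     (forall i, S (x i)) /\ v = \sum_(i < n) c i *: x i].

Definition closed_span (V : normedModType R) (S : set V) : set V :=
  closure (linear_span S).

Definition XA (F : set (set nat)) : set linfty :=
  closed_span ([set linfty_indic A | A in F] `|` c0).

Definition sphere_of (V : normedModType R) (X : set V) : set V :=
  [set x | X x /\ `|x| = 1].

Definition equilateral (V : normedModType R) (r : R) (Y : set V) : Prop :=
  forall y z, Y y -> Y z -> y <> z -> `|y - z| = r.

End linfty.

Arguments linfty_indic R A : clear implicits.
Arguments XA R F : clear implicits.

(* Main.v *)
(* Let m(a) bound A_{xi a} `&` A_{eta a}.  For b < a, call (b, a) bad when
   A_{eta b} `&` A_{xi a} does not exceed m(a).  By the Luzin property every a
   has finitely many bad b < a, so a greedy recursion colours the bad graph
   properly with natural numbers.  On an uncountable set where both m and the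
   colour are constant, no pair is bad, so for b < a some n > m(a) = m(b) lies
   in A_{eta b} and A_{xi a}, hence in neither A_{xi b} nor A_{eta a}; there
   f_a - f_b takes the value 2. *)
Require Import Defs.
From HB Require Import structures.
From mathcomp Require Import all_boot all_order all_algebra.
From mathcomp Require Import all_classical all_reals all_analysis wochoice.

Set Implicit Arguments.
Unset Strict Implicit.
Unset Printing Implicit Defensive.

Import Order.TTheory GRing.Theory Num.Theory.
Import numFieldNormedType.Exports.

Local Open Scope classical_set_scope.
Local Open Scope ring_scope.

Lemma finite_nat_ubound (S : set nat) :
  finite_set S -> exists m, forall n, S n -> (n <= m)%N.
Proof.
move=> /finite_seqP[s ->]; exists (\max_(i <- s) i)%N => n /= sn.
exact: (leq_bigmax_seq (F := id) n).
Qed.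

Lemma set_max_le (S : set nat) (m : nat) :
  (forall n, S n -> (n <= m)%N) -> (set_max S <= m)%N.
Proof.
move=> Sm; rewrite /set_max; case: finite_supportP => [_|X XS _ _].
  (* Infinite support makes the big operator collapse to its default [0]. *)
  by rewrite big_nil.
by apply/(bigmax_leqP_seq _ xpredT) => n /XS /Sm.
Qed.

(** A least non-accessible point would have only accessible predecessors, hence be accessible
    itself. *)
Lemma well_order_wf (d : Order.disp_t) (W : orderType d) :
  well_order (fun x y : W => (x <= y)%O) ->
  well_founded (fun x y : W => (x < y)%O).
Proof.
move=> wo a; apply: contrapT => nacc.
have [|z [[zA zmin] _]] :=
  wo [pred x | `[< ~ Acc (fun x y : W => (x < y)%O) x >]].
  by exists a; apply/asboolP.
move: zA => /asboolP; apply; constructor => y yz.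
apply: contrapT => /asboolP /(zmin y).
by rewrite leNgt yz.
Qed.

(** Each point receives a colour above those of its finitely many [E]-predecessors, so colours even
    increase strictly along [E]. *)
Lemma wf_finite_proper_coloring (T : Type) (E : T -> T -> Prop) :
  well_founded E -> (forall a, finite_set [set b | E b a]) ->
  exists c : T -> nat, forall b a, E b a -> c b <> c a.
Proof.
move=> wfE finE.
pose F (a : T) (rec : forall b, E b a -> nat) : nat :=
  xget 0%N [set n | forall b (h : E b a), (rec b h < n)%N].
pose c := Fix wfE (fun=> nat) F.
have cE a : c a = xget 0%N [set n | forall b, E b a -> (c b < n)%N].
  rewrite /c Fix_eq// => x f g fg; congr xget.
  by apply/funext => n /=; apply/propext; split=> + b h => /(_ b h); rewrite fg.
exists c => b a Eba.
have [m cm] := finite_nat_ubound (finite_image c (finE a)).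
suff : (c b < c a)%N by move=> + ba; rewrite ba ltnn.
(* The default [0] of [xget] never arises: [m.+1] exceeds every predecessor's colour. *)
rewrite [c a]cE; case: xgetP => [_ _ /(_ b Eba)//|/(_ m.+1)[]] b' Eb'.
by rewrite ltnS; apply: cm; exists b'.
Qed.

Lemma uncountable_fiber (T : Type) (C : countType) (c : T -> C) :
  ~ countable [set: T] -> exists k, ~ countable (c @^-1` [set k]).
Proof.
move=> ncT; apply: contrapT => /forallNP cf; apply: ncT.
have -> : [set: T] = \bigcup_(k in [set: C]) (c @^-1` [set k]).
  by apply/seteqP; split=> // x _; exists (c x).
by apply: bigcup_countable => // k _; exact: contrapT (cf k).
Qed.

Section norms.
Variable R : realType.

Lemma linfty_norm_attained (x : linfty R) (M : R) (n : nat) :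
  (forall k, `|x k| <= M) -> `|x n| = M -> `|x| = M.
Proof.
move=> xM xn; apply/eqP; rewrite eq_le; apply/andP; split.
  exact: linfty_norm_le.
by rewrite -xn; exact: linfty_norm_ub.
Qed.

Lemma linfty_indicBE (A B : set nat) (k : nat) :
  (linfty_indic R A - linfty_indic R B) k = (k \in A)%:R - (k \in B)%:R.
Proof. by rewrite -!indicE. Qed.

Lemma indicB_le1 (A B : set nat) (k : nat) :
  `|(linfty_indic R A - linfty_indic R B) k| <= 1.
Proof.
rewrite linfty_indicBE; case: (k \in A); case: (k \in B);
  by rewrite ?subrr ?subr0 ?sub0r ?normrN ?normr1 ?normr0.
Qed.

Lemma norm_indicB (A B : set nat) (n : nat) : A n -> ~ B n ->
  `|linfty_indic R A - linfty_indic R B| = 1.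
Proof.
move=> An Bn; apply: (@linfty_norm_attained _ _ n); first exact: indicB_le1.
by rewrite linfty_indicBE mem_set// memNset// subr0 normr1.
Qed.

(** The triangle inequality caps the norm at 2, and at [n] the two differences are 1 and -1. *)
Lemma norm_indicBB (A B C D : set nat) (n : nat) :
  A n -> ~ B n -> ~ C n -> D n ->
  `|(linfty_indic R A - linfty_indic R B) -
    (linfty_indic R C - linfty_indic R D)| = 2.
Proof.
move=> An Bn Cn Dn.
have subE (x y : linfty R) k : (x - y) k = x k - y k by [].
apply: (@linfty_norm_attained _ _ n) => [k|]; rewrite subE.
  by rewrite (le_trans (ler_normB _ _))// lerD// indicB_le1.
rewrite !linfty_indicBE mem_set// memNset// memNset// mem_set//.
by rewrite subr0 sub0r opprK ger0_norm.
Qed.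

Lemma XA_indicB (F : set (set nat)) (A B : set nat) : F A -> F B ->
  XA R F (linfty_indic R A - linfty_indic R B).
Proof.
move=> FA FB; apply: subset_closure.
exists 2%N, (fun i => if i == ord0 then 1 else -1).
exists (fun i => linfty_indic R (if i == ord0 then A else B)); split.
  by move=> i; left; case: ifP => _; [exists A|exists B].
by rewrite big_ord_recl big_ord1 /= scale1r scaleN1r.
Qed.

End norms.

Theorem proposition20 (R : realType) (d : Order.disp_t) (W : orderType d)
    (hW : is_omega1 W) (A : W -> set nat) (hA : luzin_family A)
    (xi eta : W -> W)
    (hxieta : forall b a : W, (b < a)%O ->
       [/\ (xi b < eta b)%O, (eta b < xi a)%O & (xi a < eta a)%O]) :
  let f := fun a : W =>
    linfty_indic R (A (xi a)) - linfty_indic R (A (eta a)) in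
  exists Gamma : set W,
    [/\ ~ countable Gamma,
        ~ countable [set f a | a in Gamma],
        equilateral 2 [set f a | a in Gamma] &
        [set f a | a in Gamma] `<=` sphere_of (XA R (range A))].
Proof.
move=> f; have [wo ncW _] := hW; have [[adA _ infA] injA luzA] := hA.
(* [hxieta] speaks of pairs of indices, so a second index, on either side of [a], is taken from the
   uncountable [W]. *)
have xe a : (xi a < eta a)%O.
  have [b ba] : exists b, b != a.
    apply: contrapT => /forallNP h; apply: ncW.
    apply: (@sub_countable _ _ _ [set a]); last exact: countable1.
    by apply: subset_card_le => b _ /=; apply/eqP; apply: contrapT => /negP /h.
  by move: ba; rewrite neq_lt => /orP[] /hxieta[].
have eta_inj : injective eta.
  move=> b a eba; apply/eqP; apply: contrapT => /negP.
  by rewrite neq_lt => /orP[] /hxieta[_ h1 h2]; have := lt_trans h1 h2;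
    rewrite eba ltxx.
have finI b a : b != a -> finite_set (A b `&` A a).
  move=> ba; apply: adA; [by exists b|by exists a|].
  by move=> /injA /eqP; rewrite (negbTE ba).
have /choice[m mP] a :
    exists k, forall n, (A (xi a) `&` A (eta a)) n -> (n <= k)%N.
  by apply: finite_nat_ubound; apply: finI; rewrite lt_eqF.
pose E b a := (b < a)%O /\ (set_max (A (eta b) `&` A (xi a)) <= m a)%N.
have wfE : well_founded E.
  apply: (well_founded_ind (well_order_wf wo)) => a IH.
  by constructor => b [ba _]; exact: IH.
have finE a : finite_set [set b | E b a].
  (* The Luzin property at [xi a], applied to each value up to [m a], leaves finitely many indices
     [eta b]; injectivity of [eta] carries this back to [b]. *)
  apply: (@sub_finite_set _ _ (eta @^-1` \bigcup_(n in `I_(m a).+1)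
      [set b | (b < xi a)%O /\ set_max (A b `&` A (xi a)) = n])).
    move=> b [/hxieta[_ ba _] mb].
    by exists (set_max (A (eta b) `&` A (xi a))); rewrite /= ?ltnS.
  apply: finite_preimage; first by move=> ? ? _ _; exact: eta_inj.
  by apply: bigcup_finite => // n _; exact: luzA.
have [c cP] := wf_finite_proper_coloring wfE finE.
have [[k l] ncG] := @uncountable_fiber _ _ (fun a => (m a, c a)) ncW.
set G := _ @^-1` _ in ncG.
have dist_lt b a : G b -> G a -> (b < a)%O -> `|f a - f b| = 2.
  move=> [mb cb] [ma ca] ba.
  have [n [nb na] kn] :
      exists2 n, (A (eta b) `&` A (xi a)) n & (k < n)%N.
    (* Without such an [n] the maximum would be at most [k = m a], making [E b a] hold between two
       points of the same colour [l]. *)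
    apply: contrapT => /forall2NP h; apply: (cP b a); last by rewrite cb ca.
    split=> //; rewrite ma; apply: set_max_le => n Sn; rewrite leqNgt.
    by apply/negP; case: (h n).
  apply: (@norm_indicBB _ _ _ _ _ n) => // hn.
    by have := mP a n (conj na hn); rewrite ma leqNgt kn.
  by have := mP b n (conj hn nb); rewrite mb leqNgt kn.
have dist b a : G b -> G a -> b != a -> `|f a - f b| = 2.
  move=> Gb Ga; rewrite neq_lt => /orP[|] h; first exact: dist_lt.
  by rewrite distrC; exact: dist_lt.
(* Distance 2 separates the values of [f] on [G], so the image is as uncountable as [G]. *)
have f_inj : {in G &, injective f}.
  move=> b a /set_mem Gb /set_mem Ga fba; apply/eqP; apply: contrapT => /negP.
  by move=> /(dist _ _ Gb Ga)/eqP; rewrite fba subrr normr0 eq_sym pnatr_eq0.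
exists G; split=> //.
- by rewrite (eq_countable (inj_card_eq f_inj)).
- move=> _ _ [b Gb <-] [a Ga <-] fab; apply: dist => //.
  by apply/eqP => ab; apply: fab; rewrite ab.
move=> _ [a _ <-]; split.
  by apply: XA_indicB; [exists (xi a)|exists (eta a)].
have [n [An nAn]] : A (xi a) `\` A (eta a) !=set0.
  (* The difference is rewritten as [A (xi a)] minus its finite intersection with [A (eta a)], hence
     is infinite. *)
  apply: infinite_setN0; rewrite -[_ `\` _]set0U -(setDv (A (xi a))) -setDIr.
  apply: infinite_setD; last by apply: finI; rewrite lt_eqF.
  by apply: infA; exists (xi a).
exact: norm_indicB An nAn.
Qed.
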